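(* Let $f:\mathbb{R}^n\to\mathbb{R}$ be continuously differentiable with a minimizer $x_*$. Suppose that $\nabla f$ is Lipschitz continuous with constant $L>0$ and that $f$ is strongly convex with parameter $\mu>0$. Let $\rho$ be a constant with $0<\rho\le\mu/L$. Let $x_0\in\mathbb{R}^n$, let $(e_k)_{k\ge 0}$ be a sequence in $\mathbb{R}^n$, and define $x_{k+1}=x_k-\frac1L\big(\nabla f(x_k)+e_k\big)$ for $k\ge0$. Suppose that there are real sequences $(\pi_k)_{k\ge0}$ and $(B_k)_{k\ge0}$ such that for all $k\ge 0$ $$0\le \pi_k\le f(x_k)-f(x_* ),\qquad 0\le B_k\le 2L(\mu/L-\rho)\,\pi_k,\qquad \|e_k\|^2\le B_k .$$ Then for all $k\ge0$, $$f(x_{k+1})-f(x_* )\le(1-\rho)\,[f(x_k)-f(x_* )].$$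
   Context: $\|\cdot\|$ is the Euclidean norm on $\mathbb{R}^n$. Lipschitz continuity of the gradient with constant $L$ means $\|\nabla f(x)-\nabla f(y)\|\le L\|x-y\|$ for all $x,y\in\mathbb{R}^n$. Strong convexity with parameter $\mu$ means $f(y)\ge f(x)+(y-x)^T\nabla f(x)+\frac{\mu}{2}\|y-x\|^2$ for all $x,y\in\mathbb{R}^n$. *)

(* Defs.v *)
From HB Require Import structures.
From mathcomp Require Import all_boot all_order all_algebra.
From mathcomp Require Import all_classical all_reals all_analysis.

Set Implicit Arguments.
Unset Strict Implicit.
Unset Printing Implicit Defensive.

Import Order.TTheory GRing.Theory Num.Theory.
Import numFieldNormedType.Exports.

Local Open Scope ring_scope.

(* The library norm `|u| on 'rV[R]_n is the maximum norm, hence the separate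
   Euclidean norm below; both norms induce the same topology and the same
   notion of (Frechet) differentiability. *)
Definition dotrv (R : realType) (n : nat) (u v : 'rV[R]_n) : R :=
  \sum_(i < n) u 0 i * v 0 i.

Definition enorm (R : realType) (n : nat) (u : 'rV[R]_n) : R :=
  Num.sqrt (dotrv u u).

Definition gradient (R : realType) (n : nat) (f : 'rV[R]_n -> R)
    (x : 'rV[R]_n) : 'rV[R]_n :=
  \row_(i < n) 'D_(delta_mx 0 i) f x.

Definition continuously_differentiable (R : realType) (n : nat)
    (f : 'rV[R]_n -> R) : Prop :=
  (forall x, differentiable f x) /\ continuous (gradient f).

Definition minimizer (R : realType) (n : nat) (f : 'rV[R]_n -> R)
    (xs : 'rV[R]_n) : Prop :=
  forall y, f xs <= f y.

Definition lipschitz_gradient (R : realType) (n : nat) (f : 'rV[R]_n -> R)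
    (L : R) : Prop :=
  forall x y, enorm (gradient f x - gradient f y) <= L * enorm (x - y).

Definition strongly_convex (R : realType) (n : nat) (f : 'rV[R]_n -> R)
    (mu : R) : Prop :=
  forall x y,
    f x + dotrv (y - x) (gradient f x) + mu / 2 * enorm (y - x) ^+ 2 <= f y.

(* Main.v *)
(** One step decreases [f] by at least [(|g|^2 - |e|^2) / (2 L)], where [g] is
    the gradient at [x k] and [e] the error (descent lemma), while strong
    convexity gives the Polyak-Lojasiewicz inequality
    [2 mu (f (x k) - f xs) <= |g|^2]; the bound on [|e|^2] then absorbs the
    remaining error.
    The descent lemma is obtained without differentiating along a segment: the
    first-order convexity inequality gives it with constant [L] instead of
    [L / 2], and applying it on both halves of the segment turns a constant
    [c L] into [(c / 2 + 1 / 4) L], a contraction with fixed point [L / 2]. *)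
Require Import Defs.
From HB Require Import structures.
From mathcomp Require Import all_boot all_order all_algebra.
From mathcomp Require Import all_classical all_reals all_analysis.
From mathcomp Require Import ring lra.

Import Order.TTheory GRing.Theory Num.Theory.
Import numFieldNormedType.Exports.

Local Open Scope ring_scope.

Section DotProduct.
Context {R : realType} {n : nat}.
Implicit Types (u v w : 'rV[R]_n) (a : R).

Lemma dotrvC u v : dotrv u v = dotrv v u.
Proof. by apply: eq_bigr => i _; rewrite mulrC. Qed.

Lemma dotrvDl u v w : dotrv (u + v) w = dotrv u w + dotrv v w.
Proof.
by rewrite /dotrv -big_split; apply: eq_bigr => i _; rewrite mxE mulrDl.
Qed.

Lemma dotrvDr u v w : dotrv w (u + v) = dotrv w u + dotrv w v.
Proof. by rewrite dotrvC dotrvDl !(dotrvC w). Qed.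

Lemma dotrvZl a u v : dotrv (a *: u) v = a * dotrv u v.
Proof.
by rewrite /dotrv mulr_sumr; apply: eq_bigr => i _; rewrite mxE mulrA.
Qed.

Lemma dotrvZr a u v : dotrv u (a *: v) = a * dotrv u v.
Proof. by rewrite dotrvC dotrvZl dotrvC. Qed.

Lemma dotrvNl u v : dotrv (- u) v = - dotrv u v.
Proof. by rewrite -scaleN1r dotrvZl mulN1r. Qed.

Lemma dotrvNr u v : dotrv u (- v) = - dotrv u v.
Proof. by rewrite dotrvC dotrvNl dotrvC. Qed.

Lemma dotrv_ge0 u : 0 <= dotrv u u.
Proof. by apply: sumr_ge0 => i _; rewrite -expr2 sqr_ge0. Qed.

Lemma enorm_ge0 u : 0 <= enorm u.
Proof. exact: sqrtr_ge0. Qed.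

Lemma enorm_sqr u : enorm u ^+ 2 = dotrv u u.
Proof. by rewrite sqr_sqrtr // dotrv_ge0. Qed.

(** Expanding [|u - a v|^2 >= 0] bounds [2 a <v, u>] by [|u|^2 + a^2 |v|^2], hence by
    [2 a^2 |v|^2]. *)
Lemma dotrv_le_enorm a u v :
  0 < a -> enorm u <= a * enorm v -> dotrv v u <= a * dotrv v v.
Proof.
move=> a_gt0 le_uv.
have le_sqr : dotrv u u <= a ^+ 2 * dotrv v v.
  rewrite -!enorm_sqr -exprMn ler_sqr ?nnegrE ?enorm_ge0 //.
  by rewrite mulr_ge0 ?enorm_ge0 // ltW.
have := dotrv_ge0 (u - a *: v).
rewrite !(dotrvDl, dotrvDr, dotrvNl, dotrvNr, dotrvZl, dotrvZr) (dotrvC u v).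
move=> sqr_ge0; rewrite -(ler_pM2l a_gt0); nra.
Qed.

End DotProduct.

Lemma ler_addgeo {R : realType} (a b K : R) :
  (forall m : nat, a <= b + K * 2 ^- m) -> a <= b.
Proof.
move=> le_ab; apply/ler_addgt0Pr => eps eps_gt0.
have [K_le0|K_gt0] := leP K 0.
  apply: (le_trans (le_ab 0%N)); rewrite expr0 invr1 mulr1.
  by rewrite lerD2l (le_trans K_le0) // ltW.
(* Since [m < 2 ^ m], an Archimedean bound [m] for [K / eps] brings [K * 2 ^- m] below [eps]. *)
have [m lt_m] : exists m : nat, K / eps < m%:R.
  by exists (Num.bound (K / eps)); apply: archi_boundP; rewrite divr_ge0 ?ltW.
apply: (le_trans (le_ab m)); rewrite lerD2l ler_pdivrMr ?exprn_gt0 //.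
rewrite mulrC -ler_pdivrMr //; apply: (le_trans (ltW lt_m)).
by rewrite -natrX ler_nat ltnW // ltn_expl.
Qed.

Section SmoothConvex.
Context {R : realType} {n : nat} (f : 'rV[R]_n -> R) (L mu : R).
Hypotheses (L_gt0 : 0 < L) (f_lip : lipschitz_gradient f L).
Hypotheses (mu_gt0 : 0 < mu) (f_cvx : strongly_convex f mu).

Lemma gradient_increment x d :
  dotrv d (gradient f (x + d)) <= dotrv d (gradient f x) + L * dotrv d d.
Proof.
have := f_lip (x + d) x; rewrite [x + d - x]addrC addKr.
by move=> /(dotrv_le_enorm _ _ _ L_gt0); rewrite dotrvDr dotrvNr lerBlDl.
Qed.

Lemma descent_approx m x d :
  f (x + d) <= f x + dotrv d (gradient f x)
               + (1 + 2 ^- m) / 2 * L * dotrv d d.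
Proof.
elim: m x d => [|m IHm] x d.
  (* Convexity from [x + d] back to [x] involves the gradient at [x + d]; moving it to [x] costs
     [L |d|^2]. *)
  have := f_cvx (x + d) x; rewrite opprD addNKr dotrvNl enorm_sqr.
  rewrite dotrvNl dotrvNr opprK.
  have := gradient_increment x d.
  have : 0 <= mu / 2 * dotrv d d by rewrite mulr_ge0 ?dotrv_ge0 ?divr_ge0 ?ltW.
  rewrite expr0 invr1; lra.
pose h : 'rV[R]_n := 2^-1 *: d.
have d_half : d = h + h by rewrite -scalerDl -[2^-1]mul1r -splitr scale1r.
(* With [p = 2 ^- m] and [c = (1 + p) / 2], the two halves cost [2 c L |h|^2] and moving the
   gradient from [x + h] to [x] costs [L |h|^2]. As [|h|^2 = |d|^2 / 4], the new constant is
   [c / 2 + 1 / 4 = (1 + p / 2) / 2]. *)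
have := IHm (x + h) h; have := IHm x h; have := gradient_increment x h.
rewrite d_half addrA !(dotrvDl, dotrvDr) exprS invfM.
set p := 2 ^- m; lra.
Qed.

Lemma descent x d :
  f (x + d) <= f x + dotrv d (gradient f x) + L / 2 * dotrv d d.
Proof.
apply: (ler_addgeo _ _ (L / 2 * dotrv d d)) => m.
apply: (le_trans (descent_approx m x d)); rewrite le_eqVlt; apply/orP; left.
by apply/eqP; ring.
Qed.

(** The quadratic lower bound for [f y] is smallest at [y - x = - g / mu], whence the square
    completed below. *)
Lemma polyak_lojasiewicz x y :
  2 * mu * (f x - f y) <= dotrv (gradient f x) (gradient f x).
Proof.
have := f_cvx x y; rewrite enorm_sqr.
move: (gradient f x) (y - x) => g d; have := dotrv_ge0 (g + mu *: d).
rewrite !(dotrvDl, dotrvDr, dotrvZl, dotrvZr) (dotrvC g d).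
move=> sqr_ge0 cvx; have := ler_wpM2l (ltW mu_gt0) cvx; lra.
Qed.

(** For the step [- (g + e) / L], the cross terms [<g, e>] of the linear and quadratic parts
    cancel. *)
Lemma inexact_gradient_step x e :
  f (x - L^-1 *: (gradient f x + e)) <=
  f x + (dotrv e e - dotrv (gradient f x) (gradient f x)) / (2 * L).
Proof.
apply: (le_trans (descent x _)); set g := gradient f x.
rewrite !(dotrvNl, dotrvNr, dotrvDl, dotrvDr, dotrvZl, dotrvZr) (dotrvC g e).
rewrite le_eqVlt; apply/orP; left; apply/eqP; field.
by rewrite gt_eqF.
Qed.

End SmoothConvex.

Theorem theorem2p4 (R : realType) (n : nat) (f : 'rV[R]_n -> R)
    (xs : 'rV[R]_n) (L mu rho : R)
    (x0 : 'rV[R]_n) (e x : nat -> 'rV[R]_n) (pi_ B : nat -> R)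
    (f_C1 : continuously_differentiable f)
    (xs_min : minimizer f xs)
    (L_gt0 : 0 < L) (f_lip : lipschitz_gradient f L)
    (mu_gt0 : 0 < mu) (f_cvx : strongly_convex f mu)
    (rho_gt0 : 0 < rho) (rho_le : rho <= mu / L)
    (x_init : x 0%N = x0)
    (x_step : forall k, x k.+1 = x k - L^-1 *: (gradient f (x k) + e k))
    (pi_bound : forall k, 0 <= pi_ k <= f (x k) - f xs)
    (B_bound : forall k, 0 <= B k <= 2 * L * (mu / L - rho) * pi_ k)
    (e_bound : forall k, enorm (e k) ^+ 2 <= B k) :
  forall k, f (x k.+1) - f xs <= (1 - rho) * (f (x k) - f xs).
Proof.
move=> k; have /andP[_ pi_le] := pi_bound k; have /andP[_ B_le] := B_bound k.
rewrite x_step; set g := gradient f (x k).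
have step := inexact_gradient_step f L mu L_gt0 f_lip mu_gt0 f_cvx (x k) (e k).
have pl := polyak_lojasiewicz f mu mu_gt0 f_cvx (x k) xs.
have e_le : dotrv (e k) (e k) <= 2 * L * (mu / L - rho) * (f (x k) - f xs).
  rewrite -enorm_sqr; apply: (le_trans (e_bound k)); apply: (le_trans B_le).
  (* [rho <= mu / L] makes the factor of [pi_ k] nonnegative. *)
  by rewrite ler_wpM2l // mulr_ge0 ?subr_ge0 // mulr_ge0 // ltW.
rewrite lerBlDr; apply: (le_trans step).
rewrite -lerBrDl ler_pdivrMr ?mulr_gt0 //.
have mu_L : mu / L * L = mu by rewrite divfK // gt_eqF.
(* Writing [mu] as [q * L] lets the [q] terms of [pl] and [e_le] cancel, leaving
   [- 2 L rho (f (x k) - f xs)]. *)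
rewrite -/g -mu_L in pl; move: (mu / L) e_le pl => q e_le pl; lra.
Qed.
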